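(* Let $(\eta_i)_{i\ge0}$ and $(\theta_j)_{j\ge0}$ be two sequences of pairwise distinct complex numbers. Let $N\ge1$ and consider the associated $d$, $m$, $\mathcal{P}_N$ and $\Omega_N=\{H_1,\ldots,H_N\}$ (defined in the context). Then the fundamental Lagrange polynomials $l^{(N)}_{H_k}$ exist, i.e. for all $k=1,\ldots,N$ there is $l^{(N)}_{H_k}\in\mathcal{P}_N$ with $l^{(N)}_{H_k}(H_l)=\delta_{k,l}$ for all $l=1,\ldots,N$. In addition, for $k=1,\ldots,N$ let $p,q$ be such that $H_k=(\eta_p,\theta_q)$. Then for all $(z,w)\in\mathbb{C}^2$: (1) if $p+q=d$, or $p+q=d-1$ and $p\ge m+1$, then $$l^{(N)}_{(\eta_p,\theta_q)}(z,w)=\prod_{i=0}^{p-1}\frac{z-\eta_i}{\eta_p-\eta_i}\prod_{j=0}^{q-1}\frac{w-\theta_j}{\theta_q-\theta_j};$$ (2) if $p+q=d-1$ and $p=m$, then $$l^{(N)}_{(\eta_m,\theta_{d-m-1})}(z,w)=\prod_{i=0}^{m-1}\frac{z-\eta_i}{\eta_m-\eta_i}\prod_{j=0,j\ne d-m-1}^{d-m}\frac{w-\theta_j}{\theta_{d-m-1}-\theta_j};$$ (3) if $p+q=d-1$ and $0\le p\le m-1$, then $$l^{(N)}_{(\eta_p,\theta_q)}(z,w)=\prod_{i=0,i\ne p}^{p+1}\frac{z-\eta_i}{\eta_p-\eta_i}\prod_{j=0}^{q-1}\frac{w-\theta_j}{\theta_q-\theta_j}-\prod_{i=0}^{p-1}\frac{z-\eta_i}{\eta_p-\eta_i}\prod_{j=0}^{q-1}\frac{w-\theta_j}{\theta_q-\theta_j}+\prod_{i=0}^{p-1}\frac{z-\eta_i}{\eta_p-\eta_i}\prod_{j=0,j\ne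 q}^{q+1}\frac{w-\theta_j}{\theta_q-\theta_j};$$ (4) if $0\le p+q\le d-2$, $0\le p\le m-1$ and $0\le q\le d-m-1$, then $$\begin{aligned}l^{(N)}_{(\eta_p,\theta_q)}(z,w)=\;&\prod_{i=0}^{p-1}\frac{z-\eta_i}{\eta_p-\eta_i}\prod_{j=0,j\ne q}^{d-p}\frac{w-\theta_j}{\theta_q-\theta_j}-\prod_{i=0}^{p-1}\frac{z-\eta_i}{\eta_p-\eta_i}\prod_{j=0,j\ne q}^{d-p-1}\frac{w-\theta_j}{\theta_q-\theta_j}+\prod_{i=0,i\ne p}^{p+1}\frac{z-\eta_i}{\eta_p-\eta_i}\prod_{j=0,j\ne q}^{d-p-1}\frac{w-\theta_j}{\theta_q-\theta_j}\\&+\sum_{r=1}^{m-p-1}\left[\prod_{i=0,i\ne p}^{p+r+1}\frac{z-\eta_i}{\eta_p-\eta_i}\prod_{j=0,j\ne q}^{d-p-r-1}\frac{w-\theta_j}{\theta_q-\theta_j}-\prod_{i=0,i\ne p}^{p+r}\frac{z-\eta_i}{\eta_p-\eta_i}\prod_{j=0,j\ne q}^{d-p-r-1}\frac{w-\theta_j}{\theta_q-\theta_j}\right]\\&+\sum_{r=m-p}^{d-p-q-2}\left[\prod_{i=0,i\ne p}^{p+r+1}\frac{z-\eta_i}{\eta_p-\eta_i}\prod_{j=0,j\ne q}^{d-p-r-2}\frac{w-\theta_j}{\theta_q-\theta_j}-\prod_{i=0,i\ne p}^{p+r}\frac{z-\eta_i}{\eta_p-\eta_i}\prod_{j=0,j\ne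 q}^{d-p-r-2}\frac{w-\theta_j}{\theta_q-\theta_j}\right];\end{aligned}$$ (5) if $0\le p+q\le d-2$, $0\le p\le m-1$ and $q\ge d-m$, then $$\begin{aligned}l^{(N)}_{(\eta_p,\theta_q)}(z,w)=\;&\prod_{i=0}^{p-1}\frac{z-\eta_i}{\eta_p-\eta_i}\prod_{j=0,j\ne q}^{d-p}\frac{w-\theta_j}{\theta_q-\theta_j}-\prod_{i=0}^{p-1}\frac{z-\eta_i}{\eta_p-\eta_i}\prod_{j=0,j\ne q}^{d-p-1}\frac{w-\theta_j}{\theta_q-\theta_j}+\prod_{i=0,i\ne p}^{p+1}\frac{z-\eta_i}{\eta_p-\eta_i}\prod_{j=0,j\ne q}^{d-p-1}\frac{w-\theta_j}{\theta_q-\theta_j}\\&+\sum_{r=1}^{d-p-q-1}\left[\prod_{i=0,i\ne p}^{p+r+1}\frac{z-\eta_i}{\eta_p-\eta_i}\prod_{j=0,j\ne q}^{d-p-r-1}\frac{w-\theta_j}{\theta_q-\theta_j}-\prod_{i=0,i\ne p}^{p+r}\frac{z-\eta_i}{\eta_p-\eta_i}\prod_{j=0,j\ne q}^{d-p-r-1}\frac{w-\theta_j}{\theta_q-\theta_j}\right];\end{aligned}$$ (6) if $p+q\le d-2$ and $p=m$, then $$\begin{aligned}l^{(N)}_{(\eta_m,\theta_q)}(z,w)=\;&\prod_{i=0}^{m-1}\frac{z-\eta_i}{\eta_m-\eta_i}\prod_{j=0,j\ne q}^{d-m}\frac{w-\theta_j}{\theta_q-\theta_j}-\prod_{i=0}^{m-1}\frac{z-\eta_i}{\eta_m-\eta_i}\prod_{j=0,j\ne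 q}^{d-m-2}\frac{w-\theta_j}{\theta_q-\theta_j}+\prod_{i=0,i\ne m}^{m+1}\frac{z-\eta_i}{\eta_m-\eta_i}\prod_{j=0,j\ne q}^{d-m-2}\frac{w-\theta_j}{\theta_q-\theta_j}\\&+\sum_{r=1}^{d-m-q-2}\left[\prod_{i=0,i\ne m}^{m+r+1}\frac{z-\eta_i}{\eta_m-\eta_i}\prod_{j=0,j\ne q}^{d-m-r-2}\frac{w-\theta_j}{\theta_q-\theta_j}-\prod_{i=0,i\ne m}^{m+r}\frac{z-\eta_i}{\eta_m-\eta_i}\prod_{j=0,j\ne q}^{d-m-r-2}\frac{w-\theta_j}{\theta_q-\theta_j}\right];\end{aligned}$$ (7) if $p+q\le d-2$ and $p\ge m+1$, then $$\begin{aligned}l^{(N)}_{(\eta_p,\theta_q)}(z,w)=\;&\prod_{i=0}^{p-1}\frac{z-\eta_i}{\eta_p-\eta_i}\prod_{j=0,j\ne q}^{d-p-1}\frac{w-\theta_j}{\theta_q-\theta_j}-\prod_{i=0}^{p-1}\frac{z-\eta_i}{\eta_p-\eta_i}\prod_{j=0,j\ne q}^{d-p-2}\frac{w-\theta_j}{\theta_q-\theta_j}+\prod_{i=0,i\ne p}^{p+1}\frac{z-\eta_i}{\eta_p-\eta_i}\prod_{j=0,j\ne q}^{d-p-2}\frac{w-\theta_j}{\theta_q-\theta_j}\\&+\sum_{r=1}^{d-p-q-2}\left[\prod_{i=0,i\ne p}^{p+r+1}\frac{z-\eta_i}{\eta_p-\eta_i}\prod_{j=0,j\ne q}^{d-p-r-2}\frac{w-\theta_j}{\theta_q-\theta_j}-\prod_{i=0,i\ne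 p}^{p+r}\frac{z-\eta_i}{\eta_p-\eta_i}\prod_{j=0,j\ne q}^{d-p-r-2}\frac{w-\theta_j}{\theta_q-\theta_j}\right].\end{aligned}$$
   Context: Convention: empty sums are $0$ and empty products are $1$. Put $N_d=\frac{(d+1)(d+2)}{2}$ for $d\ge0$ and $N_{-1}=0$. For $N\ge1$, $d\ge0$ and $m$ with $0\le m\le d$ are the unique integers such that $N_{d-1}<N\le N_d$ and $m=N-N_{d-1}-1$. Numeration: $n\mapsto(k(n),l(n))$, $n\ge1$, enumerates $\mathbb{N}^2$ ($\mathbb{N}=\{0,1,\ldots\}$) by increasing $k+l$, and for equal $k+l$ by increasing $k$: $(0,0),(0,1),(1,0),(0,2),(1,1),(2,0),\ldots$ The intertwining sequence is $H_n=(\eta_{k(n)},\theta_{l(n)})$, $n\ge1$, and $$\Omega_N=\{H_1,\ldots,H_N\}=\{(\eta_0,\theta_0),(\eta_0,\theta_1),(\eta_1,\theta_0),\ldots,(\eta_{d-1},\theta_0),(\eta_0,\theta_d),\ldots,(\eta_m,\theta_{d-m})\}.$$ $\mathcal{P}_N=\mathrm{span}\{z^{k(n)}w^{l(n)}:1\le n\le N\}$, i.e. the space spanned by the polynomials in $\mathbb{C}[z,w]$ of total degree at most $d-1$ together with $w^d,zw^{d-1},\ldots,z^mw^{d-m}$. The fundamental Lagrange polynomial $l^{(N)}_{H_k}$ is the element of $\mathcal{P}_N$ taking the value $1$ at $H_k$ and $0$ at the other points of $\Omega_N$; equivalently, $l^{(N)}_{H_k}(z,w)=\mathrm{VDM}(H_1,\ldots,H_{k-1},(z,w),H_{k+1},\ldots,H_N)/\mathrm{VDM}(H_1,\ldots,H_N)$,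 where $\mathrm{VDM}(X_1,\ldots,X_N)=\det[e_i(X_j)]_{1\le i,j\le N}$ with $e_n(z,w)=z^{k(n)}w^{l(n)}$. *)

(* Defs.v *)
(* The complex numbers are R[i] over an arbitrary R : realType,
   and C[z, w] is {mpoly R[i][2]}. *)
From mathcomp Require Import all_boot all_order all_algebra.
From mathcomp Require Import reals complex mpoly.
From mathcomp Require Import zify.

Set Implicit Arguments.
Unset Strict Implicit.
Unset Printing Implicit Defensive.

Import Order.TTheory GRing.Theory Num.Theory.
Local Open Scope ring_scope.

Definition Ndim (d : nat) : nat := ((d + 1) * (d + 2) %/ 2)%N.

(* [Ndim_pred d] is N_{d-1}, with the convention N_{-1} = 0. *)
Definition Ndim_pred (d : nat) : nat := if d is d'.+1 then Ndim d' else 0%N.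

Definition numeration_next (kl : nat * nat) : nat * nat :=
  if kl.2 is l.+1 then (kl.1.+1, l) else (0%N, kl.1.+1).

(* n |-> (k(n), l(n)) is meant for n >= 1 only. That it enumerates all pairs,
   in the required order, is the content of the lemmas [numerationE],
   [numeration_surj] and [numeration_lt] below. *)
Definition numeration (n : nat) : nat * nat :=
  iter n.-1 numeration_next (0%N, 0%N).

Definition intertwining (C : Type) (eta theta : nat -> C) (n : nat) : C * C :=
  (eta (numeration n).1, theta (numeration n).2).

(* z is the variable of index 0 and w the variable of index 1. *)
Definition eval2 (R : realType) (L : {mpoly R[i][2]}) (zw : R[i] * R[i]) : R[i] :=
  L.@[tnth [tuple zw.1; zw.2]].

Definition in_PN (R : realType) (N : nat) (L : {mpoly R[i][2]}) : Prop :=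
  exists c : nat -> R[i],
    L = \sum_(1 <= n < N.+1)
          c n *: ('X_ord0 ^+ (numeration n).1 * 'X_ord_max ^+ (numeration n).2).

Definition is_fundamental_lagrange (R : realType) (eta theta : nat -> R[i])
    (N k : nat) (L : {mpoly R[i][2]}) : Prop :=
  in_PN N L /\
  forall l : nat, (1 <= l <= N)%N ->
    eval2 L (intertwining eta theta l) = (k == l)%:R.

(* \prod_{i=0}^{p-1} (t - x_i) / (x_p - x_i) *)
Definition prod_below (R : realType) (x : nat -> R[i]) (p : nat) (t : R[i]) :
    R[i] :=
  \prod_(0 <= i < p) ((t - x i) / (x p - x i)).

(* \prod_{i=0, i <> p}^{b} (t - x_i) / (x_p - x_i); the bound b is included. *)
Definition prod_upto (R : realType) (x : nat -> R[i]) (p b : nat) (t : R[i]) :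
    R[i] :=
  \prod_(0 <= i < b.+1 | i != p) ((t - x i) / (x p - x i)).

Lemma NdimS (d : nat) : Ndim d.+1 = (Ndim d + d.+2)%N.
Proof.
rewrite /Ndim.
have -> : ((d.+1 + 1) * (d.+1 + 2) = d.+2 * 2 + (d + 1) * (d + 2))%N by nia.
by rewrite divnMDl // addnC.
Qed.

Lemma numerationE (d m : nat) : (m <= d)%N ->
  numeration (Ndim_pred d + m).+1 = (m, d - m)%N.
Proof.
have step e : numeration (Ndim_pred e).+1 = (0, e)%N -> forall n, (n <= e)%N ->
    numeration (Ndim_pred e + n).+1 = (n, e - n)%N.
  move=> h0; elim=> [|n IHn] le_ne; first by rewrite addn0 h0 subn0.
  have := IHn (ltnW le_ne); rewrite /numeration /= addnS iterS => ->.
  by rewrite /numeration_next /=; have -> : (e - n = (e - n.+1).+1)%N by lia.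
have row0 : numeration (Ndim_pred d).+1 = (0, d)%N.
  elim: d {m} => [//|d IHd].
  have := step d IHd d (leqnn d); rewrite subnn /numeration /= => hd.
  have -> : Ndim d = (Ndim_pred d + d).+1.
    by case: (d) => [//|e]; rewrite NdimS /= -addnS.
  by rewrite iterS hd.
exact: step.
Qed.

Lemma numeration_surj (k l : nat) :
  exists2 n : nat, (1 <= n)%N & numeration n = (k, l).
Proof.
exists (Ndim_pred (k + l) + k).+1 => //.
by rewrite numerationE ?leq_addr // addKn.
Qed.

Lemma numeration_lt (n n' : nat) : (1 <= n)%N -> (n < n')%N ->
  let: (k, l) := numeration n in let: (k', l') := numeration n' in
  (k + l < k' + l')%N || (k + l == k' + l')%N && (k < k')%N.
Proof.
case: n => [//|n] _; case: n' => [//|n']; rewrite ltnS /numeration /=.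
elim: n' => [//|n' IHn']; rewrite ltnS leq_eqVlt iterS => nn'.
have {nn'} : iter n numeration_next (0, 0)%N = iter n' numeration_next (0, 0)%N \/
    (n < n')%N by case/orP: nn' => [/eqP->|]; [left | right].
case=> [->|/IHn'].
  by case: (iter n' _ _) => k [|l]; rewrite /numeration_next /=; lia.
case: (iter n _ _) (iter n' _ _) => k l [k' [|l']].
all: by rewrite /numeration_next /=; lia.
Qed.

(* Main.v *)
(* The exponents (k(n), l(n)), n <= N, form a Young diagram: they are the pairs
   (i, j) with j < h(i), h(i) = d - i + 1 if i <= m and h(i) = d - i otherwise.
   With U_n(z) = prod_(i < n, i <> p) (z - eta_i) / (eta_p - eta_i) and V_n(w)
   likewise for theta and q, all seven cases are instances of the one formula
     U_{p+1}(z) V_{h(p)}(w)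
       + sum_(i > p, q < h(i)) (U_{i+1}(z) - U_i(z)) V_{h(i)}(w),
   which lies in P_N by inspection of the exponents. Existence for all k makes
   the evaluation matrix of the monomials at Omega_N invertible, which gives
   uniqueness. *)
Require Import Defs.
From mathcomp Require Import all_boot all_order all_algebra.
From mathcomp Require Import reals complex mpoly.
From mathcomp Require Import zify ring.

Set Implicit Arguments.
Unset Strict Implicit.
Unset Printing Implicit Defensive.

Import Order.TTheory GRing.Theory Num.Theory.
Local Open Scope ring_scope.

(** * Truncated one-variable Lagrange products *)

Section LagrangeProducts.
Variables (F : fieldType) (x : nat -> F).
Hypothesis x_inj : injective x.

(** The bound [n] is excluded, unlike in [prod_upto], so that it can be a row height and a sum of
    differences telescopes. *)
Definition lagrange_prod (p n : nat) (t : F) : F :=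
  \prod_(0 <= i < n | i != p) ((t - x i) / (x p - x i)).

Lemma lagrange_prod_node p n : lagrange_prod p n (x p) = 1.
Proof.
rewrite /lagrange_prod big1 // => i ip; rewrite divff // subr_eq0.
by apply: contraNneq ip => /x_inj ->.
Qed.

Lemma lagrange_prod_eq0 p n i : (i < n)%N -> i != p -> lagrange_prod p n (x i) = 0.
Proof.
move=> i_n ip; apply/eqP; rewrite /lagrange_prod prodf_seq_eq0.
by apply/hasP; exists i; rewrite ?mem_index_iota //= ip subrr mul0r eqxx.
Qed.

Lemma lagrange_prodE p n i :
  (i < n)%N -> lagrange_prod p n (x i) = (i == p)%:R.
Proof.
move=> i_n; have [->|ip] := eqVneq i p; first exact: lagrange_prod_node.
exact: lagrange_prod_eq0.
Qed.

Lemma lagrange_prod_below p t :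
  lagrange_prod p p.+1 t = \prod_(0 <= i < p) ((t - x i) / (x p - x i)).
Proof.
rewrite /lagrange_prod big_mkcond big_nat_recr //= eqxx mulr1.
by apply: eq_big_nat => i; case: ltngtP.
Qed.

(** For [p < n] the skipped index is one of the [n] indices, which leaves [n - 1] linear factors and
    hence size at most [n]. *)
Lemma lagrange_prod_poly p n : (p < n)%N ->
  exists2 P : {poly F}, (size P <= n)%N & forall t, lagrange_prod p n t = P.[t].
Proof.
move=> p_n; pose s := [seq i <- index_iota 0 n | i != p].
exists ((\prod_(i <- s) (x p - x i)^-1) *: \prod_(i <- s) ('X - (x i)%:P)).
  apply: leq_trans (size_scale_leq _ _) _; rewrite size_prod_XsubC.
  have := count_predC (pred1 p) (index_iota 0 n).
  rewrite (count_uniq_mem _ (iota_uniq _ _)) mem_index_iota p_n size_iota.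
  have -> : size s = count (predC (pred1 p)) (index_iota 0 n) by rewrite size_filter.
  lia.
move=> t; rewrite hornerZ horner_prod -big_split big_filter /=.
by apply: eq_bigr => i _; rewrite !hornerE mulrC.
Qed.

End LagrangeProducts.

(** * Lagrange interpolation on a Young diagram of nodes *)

Section LowerSet.
Variables (F : fieldType) (x y : nat -> F).
Hypotheses (x_inj : injective x) (y_inj : injective y).
Variable h : nat -> nat.
Hypothesis h_anti : forall i j, (i <= j)%N -> (h j <= h i)%N.

(** [e] is meant to be the number of rows [i] with [q < h i]; as heights decrease, [i < e] expresses
    that condition. *)
Definition lower_lagrange (e p q : nat) (z w : F) : F :=
  lagrange_prod x p p.+1 z * lagrange_prod y q (h p) w
  + \sum_(p.+1 <= i < e)
      (lagrange_prod x p i.+1 z - lagrange_prod x p i z)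
        * lagrange_prod y q (h i) w.

(* On the row [i = a] only the terms with index at most [a] survive, where the
   second factors all take the value [b == q]; the first factors telescope. *)
Lemma lower_lagrangeE (e p q a b : nat) :
    (forall i, (q < h i)%N = (i < e)%N) -> (p < e)%N -> (b < h a)%N ->
  lower_lagrange e p q (x a) (y b) = ((a == p) && (b == q))%:R.
Proof.
move=> he p_e b_ha; rewrite /lower_lagrange.
have late i : (a < i)%N -> lagrange_prod x p i.+1 (x a) - lagrange_prod x p i (x a) = 0.
  by move=> a_i; rewrite !lagrange_prodE ?subrr // ltnS ltnW.
have early i : (i <= a)%N -> lagrange_prod y q (h i) (y b) = (b == q)%:R.
  by move=> i_a; rewrite lagrange_prodE // (leq_trans b_ha) ?h_anti.
have [a_p|p_a] := leqP a p.
  rewrite big_nat big1 => [|i /andP[p_i _]]; last first.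
    by rewrite late ?mul0r // (leq_ltn_trans a_p).
  rewrite addr0 lagrange_prodE //; have [ap|_] := eqVneq a p; last by rewrite mul0r.
  by rewrite mul1r early ?ap.
move: b_ha early; have [-> a_e early|b_q b_ha early] := eqVneq b q; last first.
  rewrite early ?(ltnW p_a) // mulr0 add0r andbF big_nat big1 // => i _.
  have [i_a|/late->] := leqP i a; last by rewrite mul0r.
  by rewrite early ?mulr0.
(* For [b = q] the node condition [b < h a] becomes [a < e], so the sum reaches index [a] and can be
   cut just after it. *)
move: a_e; rewrite he => a_e.
rewrite early ?(ltnW p_a) // mulr1 (big_cat_nat (n := a.+1)) //=; last lia.
rewrite [X in _ + (_ + X)](_ : _ = 0) ?addr0; last first.
  by rewrite big_nat big1 // => i /andP[/late-> _]; rewrite mul0r.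
under eq_big_nat => i /andP[_ i_a] do rewrite early // mulr1.
rewrite telescope_sumr; last lia.
by rewrite addrC subrK lagrange_prodE ?andbT.
Qed.

End LowerSet.

(** * The numeration and its Young diagram *)

Lemma numeration_inj n n' : (0 < n)%N -> (0 < n')%N ->
  numeration n = numeration n' -> n = n'.
Proof.
move=> n_gt0 n'_gt0 nn'.
case: (ltngtP n n') => // [/(numeration_lt n_gt0)|/(numeration_lt n'_gt0)].
all: by rewrite nn'; case: (numeration n') => a b; rewrite !ltnn andbF.
Qed.

Lemma numeration_le n N : (0 < n)%N -> (0 < N)%N ->
  (n <= N)%N = (let: (a, b) := numeration n in let: (k, l) := numeration N in
    (a + b < k + l)%N || (a + b == k + l)%N && (a <= k)%N).
Proof.
move=> n_gt0 N_gt0.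
case: (ltngtP n N) => [/(numeration_lt n_gt0)|/(numeration_lt N_gt0)|->].
all: case: (numeration N) => k l; try case: (numeration n) => a b; lia.
Qed.

(* The fibres of [Omega_N] over [eta_0, eta_1, ...] have these heights. *)
Definition row_height (d m i : nat) : nat := (d - i + (i <= m))%N.

Lemma row_height_anti d m i j : (i <= j)%N -> (row_height d m j <= row_height d m i)%N.
Proof. rewrite /row_height; lia. Qed.

(** The last index has exponents [(m, d - m)], so [(a, b)] comes no later iff [a + b < d], or
    [a + b = d] and [a <= m]. *)
Lemma numeration_row_height d m n : (m <= d)%N -> (0 < n)%N ->
  (n <= (Ndim_pred d + m).+1)%N = ((numeration n).2 < row_height d m (numeration n).1)%N.
Proof.
move=> m_d n_gt0; rewrite numeration_le // numerationE //.
by case: (numeration n) => a b; rewrite /row_height /=; lia.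
Qed.

(** * The span of the first monomials, and uniqueness of interpolation *)

Section BivariateSpan.
Variable F : fieldType.

(** Functions replace polynomials here because the formulas to be proved concern values;
    [in_PN_span] and [in_span_PN] translate. *)
Definition in_span (N : nat) (f : F -> F -> F) : Prop :=
  exists c : nat -> F, forall z w,
    f z w = \sum_(1 <= n < N.+1) c n * (z ^+ (numeration n).1 * w ^+ (numeration n).2).

Lemma in_span_ext N f g : (forall z w, f z w = g z w) -> in_span N g -> in_span N f.
Proof. by move=> fg [c gE]; exists c => z w; rewrite fg gE. Qed.

Lemma in_spanD N f g : in_span N f -> in_span N g -> in_span N (fun z w => f z w + g z w).
Proof.
move=> [c fE] [c' gE]; exists (fun n => c n + c' n) => z w.
by rewrite fE gE -big_split; apply: eq_bigr => n _; rewrite mulrDl.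
Qed.

Lemma in_spanZ N a f : in_span N f -> in_span N (fun z w => a * f z w).
Proof.
move=> [c fE]; exists (fun n => a * c n) => z w.
by rewrite fE mulr_sumr; apply: eq_bigr => n _; rewrite mulrA.
Qed.

Lemma in_span_sum (I : eqType) (r : seq I) N (f : I -> F -> F -> F) :
    (forall i, i \in r -> in_span N (f i)) ->
  in_span N (fun z w => \sum_(i <- r) f i z w).
Proof.
elim: r => [|i r IHr] fN.
  by exists (fun=> 0) => z w; rewrite big_nil big1 // => n _; rewrite mul0r.
apply: (@in_span_ext _ _ (fun z w => f i z w + \sum_(j <- r) f j z w)).
  by move=> z w; rewrite big_cons.
by apply: in_spanD => [|]; [|apply: IHr => j jr]; apply: fN; rewrite inE ?eqxx ?jr ?orbT.
Qed.

Lemma in_span_monomial N n : (0 < n <= N)%N ->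
  in_span N (fun z w => z ^+ (numeration n).1 * w ^+ (numeration n).2).
Proof.
move=> n_N; exists (fun k => (k == n)%:R) => z w.
rewrite (bigD1_seq n) ?iota_uniq ?mem_index_iota //= eqxx mul1r big1 ?addr0 //.
by move=> k /negPf->; rewrite mul0r.
Qed.

(** A monomial of the product has exponents [a <= i] and [b < row_height d m i <= row_height d m a],
    so it stays in the diagram. *)
Lemma in_span_prod d m (P Q : {poly F}) i : (m <= d)%N ->
    (size P <= i.+1)%N -> (size Q <= row_height d m i)%N ->
  in_span (Ndim_pred d + m).+1 (fun z w => P.[z] * Q.[w]).
Proof.
move=> m_d szP szQ.
apply: (@in_span_ext _ _ (fun z w => \sum_(a <- iota 0 (size P))
    \sum_(b <- iota 0 (size Q)) (P`_a * Q`_b) * (z ^+ a * w ^+ b))).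
  move=> z w; rewrite !horner_coef -(big_mkord xpredT (fun a => P`_a * z ^+ a)).
  rewrite -(big_mkord xpredT (fun b => Q`_b * w ^+ b)).
  rewrite big_distrlr /= /index_iota !subn0.
  by apply: eq_bigr => a _; apply: eq_bigr => b _; rewrite mulrACA.
apply: in_span_sum => a; rewrite mem_iota => /andP[_ a_P].
apply: in_span_sum => b; rewrite mem_iota => /andP[_ b_Q].
apply: in_spanZ; have [n n_gt0 nE] := numeration_surj a b.
have := @in_span_monomial (Ndim_pred d + m).+1 n; rewrite nE; apply.
rewrite n_gt0 numeration_row_height // nE /=.
apply: leq_trans b_Q (leq_trans szQ (row_height_anti _ _ _)); lia.
Qed.

(** The term of row [i] has degree at most [i] in [z] and less than the height of row [i] in [w]. *)
Lemma lower_lagrange_in_span (x y : nat -> F) d m e p q : (m <= d)%N ->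
    (forall i, (q < row_height d m i)%N = (i < e)%N) -> (p < e)%N ->
  in_span (Ndim_pred d + m).+1 (lower_lagrange x y (row_height d m) e p q).
Proof.
move=> m_d he p_e.
have prodN i n : (p < n <= i.+1)%N -> (i < e)%N -> in_span (Ndim_pred d + m).+1
    (fun z w => lagrange_prod x p n z * lagrange_prod y q (row_height d m i) w).
  move=> /andP[p_n n_i] i_e; rewrite -he in i_e.
  have [P szP PE] := lagrange_prod_poly x p_n.
  have [Q szQ QE] := lagrange_prod_poly y i_e.
  apply: (@in_span_ext _ _ (fun z w => P.[z] * Q.[w])); first by move=> z w; rewrite PE QE.
  exact: in_span_prod m_d (leq_trans szP n_i) szQ.
apply: in_spanD; first by apply: prodN; rewrite ?leqnn.
apply: in_span_sum => i; rewrite mem_index_iota => /andP[p_i i_e].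
apply: (@in_span_ext _ _ (fun z w =>
  lagrange_prod x p i.+1 z * lagrange_prod y q (row_height d m i) w
  + -1 * (lagrange_prod x p i z * lagrange_prod y q (row_height d m i) w))).
  by move=> z w; rewrite mulrBl mulN1r.
apply: in_spanD; last apply: in_spanZ; apply: prodN => //; lia.
Qed.

(* A square evaluation matrix whose rows span everything is injective. *)
Lemma in_span_unique N (H : nat -> F * F) :
    (forall k, (0 < k <= N)%N -> exists2 f, in_span N f &
       forall l, (0 < l <= N)%N -> f (H l).1 (H l).2 = (k == l)%:R) ->
  forall f g, in_span N f -> in_span N g ->
    (forall l, (0 < l <= N)%N -> f (H l).1 (H l).2 = g (H l).1 (H l).2) ->
  forall z w, f z w = g z w.
Proof.
move=> exN f g [c fE] [c' gE] fg z w.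
pose B := \matrix_(n < N, l < N)
  ((H l.+1).1 ^+ (numeration n.+1).1 * (H l.+1).2 ^+ (numeration n.+1).2).
pose u (c : nat -> F) := \row_(n < N) c n.+1.
have uB a (l : 'I_N) : (u a *m B) 0 l = \sum_(1 <= n < N.+1)
    a n * ((H l.+1).1 ^+ (numeration n).1 * (H l.+1).2 ^+ (numeration n).2).
  rewrite big_add1 big_mkord mxE; apply: eq_bigr => n _.
  by rewrite !mxE.
have freeB : row_free B.
  (* For a square matrix, free is the same as full; the coefficients of the [k]-th Lagrange function
     express the [k]-th unit row through the rows of [B]. *)
  rewrite row_free_unit -row_full_unit -sub1mx; apply/row_subP => k; rewrite row1.
  have [fk [ck fkE] fkH] := exN k.+1 (ltn_ord k).
  suff <- : u ck *m B = delta_mx 0 k by rewrite submxMl.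
  by apply/rowP => l; rewrite uB -fkE fkH ?ltn_ord // mxE eqxx eqSS eq_sym.
have /(row_free_inj freeB) cc' : u c *m B = u c' *m B.
  by apply/rowP => l; rewrite !uB -fE -gE fg ?ltn_ord.
rewrite fE gE !big_add1 !big_mkord; apply: eq_bigr => n _.
by have /rowP/(_ n) := cc'; rewrite !mxE => ->.
Qed.

End BivariateSpan.

(** * The fundamental Lagrange polynomials of the intertwining sequence *)

Section FundamentalLagrange.
Variables (R : realType) (eta theta : nat -> R[i]).
Hypotheses (eta_inj : injective eta) (theta_inj : injective theta).

Lemma eval2_monomial_sum N (c : nat -> R[i]) z w :
  eval2 (\sum_(1 <= n < N.+1) c n *: ('X_ord0 ^+ (numeration n).1
                                      * 'X_ord_max ^+ (numeration n).2)) (z, w)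
  = \sum_(1 <= n < N.+1) c n * (z ^+ (numeration n).1 * w ^+ (numeration n).2).
Proof.
rewrite /eval2 raddf_sum; apply: eq_bigr => n _.
by rewrite /= mevalZ mevalM !rmorphXn /= !mevalXU.
Qed.

Lemma in_PN_span N (L : {mpoly R[i][2]}) :
  in_PN N L -> in_span N (fun z w => eval2 L (z, w)).
Proof. by case=> c ->; exists c => z w; rewrite eval2_monomial_sum. Qed.

Lemma in_span_PN N (f : R[i] -> R[i] -> R[i]) : in_span N f ->
  exists2 L : {mpoly R[i][2]}, in_PN N L & forall z w, eval2 L (z, w) = f z w.
Proof.
case=> c fE; eexists; first by exists c.
by move=> z w; rewrite eval2_monomial_sum fE.
Qed.

Lemma intertwining_inj n p q :
  intertwining eta theta n = (eta p, theta q) -> numeration n = (p, q).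
Proof.
by rewrite /intertwining; case: (numeration n) => a b [/eta_inj-> /theta_inj->].
Qed.

(* The conjugate partition of [row_height]. *)
Definition row_length (d m q : nat) : nat :=
  (d.+1 - q - (m + q < d))%N.

Lemma row_lengthP d m q i : (m <= d)%N ->
  (q < row_height d m i)%N = (i < row_length d m q)%N.
Proof. rewrite /row_height /row_length; lia. Qed.

Definition fundamental_lagrange d m p q : R[i] -> R[i] -> R[i] :=
  lower_lagrange eta theta (row_height d m) (row_length d m q) p q.

Lemma fundamental_lagrange_in_span d m p q :
    (m <= d)%N -> (q < row_height d m p)%N ->
  in_span (Ndim_pred d + m).+1 (fundamental_lagrange d m p q).
Proof.
move=> m_d q_hp; apply: lower_lagrange_in_span => [//|i|].
  exact: row_lengthP.
by rewrite -row_lengthP.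
Qed.

Lemma fundamental_lagrangeE d m k l (N := (Ndim_pred d + m).+1) : (m <= d)%N ->
    (0 < k <= N)%N -> (0 < l <= N)%N ->
  fundamental_lagrange d m (numeration k).1 (numeration k).2
    (intertwining eta theta l).1 (intertwining eta theta l).2 = (k == l)%:R.
Proof.
move=> m_d /andP[k_gt0 k_N] /andP[l_gt0 l_N].
rewrite numeration_row_height // in k_N; rewrite numeration_row_height // in l_N.
rewrite /fundamental_lagrange lower_lagrangeE //.
- have [->|kl] := eqVneq k l; first by rewrite !eqxx.
  case: eqP => //= e1; case: eqP => //= e2; case/eqP: kl.
  apply: numeration_inj => //.
  by rewrite [LHS]surjective_pairing -e1 -e2 -surjective_pairing.
- exact: row_height_anti.
- by move=> i; rewrite row_lengthP.
- by rewrite -row_lengthP.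
Qed.

Lemma is_fundamental_lagrange_exists d m k (N := (Ndim_pred d + m).+1) :
    (m <= d)%N -> (0 < k <= N)%N ->
  exists L : {mpoly R[i][2]}, is_fundamental_lagrange eta theta N k L.
Proof.
move=> m_d k_N; have [k_gt0 k_le] := andP k_N.
rewrite numeration_row_height // in k_le.
have [L LN LE] := in_span_PN (fundamental_lagrange_in_span m_d k_le).
exists L; split=> // l l_N.
by rewrite [intertwining _ _ _]surjective_pairing LE fundamental_lagrangeE.
Qed.

(** The explicit functions for all indices supply the existence hypothesis of [in_span_unique],
    which then identifies [L]. *)
Lemma eval2_fundamental_lagrange d m k p q L (N := (Ndim_pred d + m).+1) :
    (m <= d)%N -> (0 < k <= N)%N ->
    intertwining eta theta k = (eta p, theta q) ->
    is_fundamental_lagrange eta theta N k L ->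
  forall z w, eval2 L (z, w) = fundamental_lagrange d m p q z w.
Proof.
move=> m_d k_N /intertwining_inj kE [/in_PN_span LN LE].
have span j : (0 < j <= N)%N ->
    in_span N (fundamental_lagrange d m (numeration j).1 (numeration j).2).
  case/andP=> j_gt0; rewrite numeration_row_height //.
  exact: fundamental_lagrange_in_span.
have fpq := span k k_N; rewrite kE in fpq.
apply: (in_span_unique _ LN fpq (H := intertwining eta theta)) => [j j_N|l l_N].
  exists (fundamental_lagrange d m (numeration j).1 (numeration j).2); first exact: span.
  by move=> l l_N; rewrite fundamental_lagrangeE.
rewrite -surjective_pairing LE //.
by have := fundamental_lagrangeE m_d k_N l_N; rewrite kE.
Qed.

(** The substitution [i = p + r + 1] matches the indexing of the seven cases. Every row that occurs
    is higher than [q], so its height is positive and [.-1] is a true predecessor. *)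
Lemma fundamental_lagrange_shift d m p q z w :
    (m <= d)%N -> (q < row_height d m p)%N ->
  fundamental_lagrange d m p q z w =
    prod_below eta p z * prod_upto theta q (row_height d m p).-1 w
    + \sum_(0 <= r < row_length d m q - p.+1)
        (prod_upto eta p (p + r + 1) z - prod_upto eta p (p + r) z)
          * prod_upto theta q (row_height d m (p + r + 1)).-1 w.
Proof.
move=> m_d q_hp; rewrite /fundamental_lagrange /lower_lagrange.
rewrite lagrange_prod_below; congr (_ * _ + _).
  by rewrite /prod_upto prednK ?(leq_ltn_trans _ q_hp).
rewrite -{1}[p.+1]add0n big_addn; apply: eq_big_nat => r /andP[_ r_lt].
have q_h : (q < row_height d m (p + r + 1))%N by rewrite row_lengthP //; lia.
rewrite (_ : r + p.+1 = p + r + 1)%N; last lia.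
by rewrite /prod_upto prednK ?(leq_ltn_trans _ q_h) // addn1.
Qed.

End FundamentalLagrange.

(** * Specialisation to the seven cases *)

Theorem proposition4 (R : realType) (eta theta : nat -> R[i])
  (eta_inj : injective eta) (theta_inj : injective theta)
  (N d m : nat) (N_ge1 : (1 <= N)%N)
  (dN : (Ndim_pred d < N <= Ndim d)%N)
  (mN : m = (N - Ndim_pred d - 1)%N) (md : (0 <= m <= d)%N) :
  (forall k : nat, (1 <= k <= N)%N ->
     exists L : {mpoly R[i][2]}, is_fundamental_lagrange eta theta N k L)
  /\
  (forall (k p q : nat) (L : {mpoly R[i][2]}), (1 <= k <= N)%N ->
     intertwining eta theta k = (eta p, theta q) ->
     is_fundamental_lagrange eta theta N k L ->
     forall z w : R[i],
     (* (1) *)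
     (((p + q = d)%N \/ (p + q + 1 = d)%N /\ (m + 1 <= p)%N) ->
        eval2 L (z, w) = prod_below eta p z * prod_below theta q w)
     /\
     (* (2) *)
     ((p + q + 1 = d)%N -> p = m ->
        eval2 L (z, w) =
          prod_below eta m z * prod_upto theta (d - m - 1) (d - m) w)
     /\
     (* (3) *)
     ((p + q + 1 = d)%N -> (p < m)%N ->
        eval2 L (z, w) =
          prod_upto eta p (p + 1) z * prod_below theta q w
          - prod_below eta p z * prod_below theta q w
          + prod_below eta p z * prod_upto theta q (q + 1) w)
     /\
     (* (4) *)
     ((p + q + 2 <= d)%N -> (p < m)%N -> (q < d - m)%N ->
        eval2 L (z, w) =
          prod_below eta p z * prod_upto theta q (d - p) w
          - prod_below eta p z * prod_upto theta q (d - p - 1) w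
          + prod_upto eta p (p + 1) z * prod_upto theta q (d - p - 1) w
          + \sum_(1 <= r < (m - p - 1).+1)
              (prod_upto eta p (p + r + 1) z
                 * prod_upto theta q (d - p - r - 1) w
               - prod_upto eta p (p + r) z
                 * prod_upto theta q (d - p - r - 1) w)
          + \sum_(m - p <= r < (d - p - q - 2).+1)
              (prod_upto eta p (p + r + 1) z
                 * prod_upto theta q (d - p - r - 2) w
               - prod_upto eta p (p + r) z
                 * prod_upto theta q (d - p - r - 2) w))
     /\
     (* (5) *)
     ((p + q + 2 <= d)%N -> (p < m)%N -> (d - m <= q)%N ->
        eval2 L (z, w) =
          prod_below eta p z * prod_upto theta q (d - p) w
          - prod_below eta p z * prod_upto theta q (d - p - 1) w
          + prod_upto eta p (p + 1) z * prod_upto theta q (d - p - 1) w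
          + \sum_(1 <= r < (d - p - q - 1).+1)
              (prod_upto eta p (p + r + 1) z
                 * prod_upto theta q (d - p - r - 1) w
               - prod_upto eta p (p + r) z
                 * prod_upto theta q (d - p - r - 1) w))
     /\
     (* (6) *)
     ((p + q + 2 <= d)%N -> p = m ->
        eval2 L (z, w) =
          prod_below eta m z * prod_upto theta q (d - m) w
          - prod_below eta m z * prod_upto theta q (d - m - 2) w
          + prod_upto eta m (m + 1) z * prod_upto theta q (d - m - 2) w
          + \sum_(1 <= r < (d - m - q - 2).+1)
              (prod_upto eta m (m + r + 1) z
                 * prod_upto theta q (d - m - r - 2) w
               - prod_upto eta m (m + r) z
                 * prod_upto theta q (d - m - r - 2) w))
     /\
     (* (7) *)
     ((p + q + 2 <= d)%N -> (m + 1 <= p)%N ->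
        eval2 L (z, w) =
          prod_below eta p z * prod_upto theta q (d - p - 1) w
          - prod_below eta p z * prod_upto theta q (d - p - 2) w
          + prod_upto eta p (p + 1) z * prod_upto theta q (d - p - 2) w
          + \sum_(1 <= r < (d - p - q - 2).+1)
              (prod_upto eta p (p + r + 1) z
                 * prod_upto theta q (d - p - r - 2) w
               - prod_upto eta p (p + r) z
                 * prod_upto theta q (d - p - r - 2) w))).
Proof.
Proof.
have NE : N = (Ndim_pred d + m).+1 by lia.
have {}md : (m <= d)%N by case/andP: md.
subst N; split=> [k k_N|k p q L k_N Hk LH z w]; first exact: is_fundamental_lagrange_exists.
rewrite (eval2_fundamental_lagrange eta_inj theta_inj md k_N Hk LH) => {L LH}.
have q_hp : (q < row_height d m p)%N.
  have := k_N; case/andP=> k_gt0; rewrite numeration_row_height //.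
  by rewrite (intertwining_inj eta_inj theta_inj Hk).
rewrite fundamental_lagrange_shift //.
have belowE (x : nat -> R[i]) i t : prod_below x i t = prod_upto x i i t.
  by rewrite /prod_below -lagrange_prod_below.
rewrite !belowE; move: q_hp; rewrite /row_height /row_length => q_hp.
(* Case (1): row [p] has height [q + 1] and no later row is higher than [q], so the sum is empty. *)
split=> [pq|].
  have -> : (d - p + (p <= m)).-1 = q by lia.
  by rewrite big_geq ?addr0 //; lia.
split=> [pq pm|].
  subst p; rewrite big_geq ?addr0; last lia.
  have -> : (d - m + (m <= m)).-1 = (d - m)%N by lia.
  by have -> : q = (d - m - 1)%N by lia.
(* Case (3): the only later row higher than [q] is [p + 1], of height [q + 1]. *)
split=> [pq pm|].
  have -> : (d.+1 - q - (m + q < d) - p.+1 = 1)%N by lia.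
  rewrite big_nat1 addn0.
  have -> : (d - p + (p <= m)).-1 = (q + 1)%N by lia.
  have -> : (d - (p + 1) + (p + 1 <= m)).-1 = q by lia.
  by ring.
(* Case (4): the term [r = 0] joins the leading terms. The rest splits at [r = m - p], where row
   [p + r + 1] first exceeds [m] and the height formula loses its extra unit. *)
split=> [pq pm qm|].
  have -> : (d.+1 - q - (m + q < d) - p.+1 = (d - p - q - 2).+1)%N by lia.
  rewrite big_ltn // (big_cat_nat (n := m - p)) /=; [|lia|lia].
  have -> : (m - p - 1).+1 = (m - p)%N by lia.
  have -> : (d - p + (p <= m)).-1 = (d - p)%N by lia.
  have -> : (d - (p + 0 + 1) + (p + 0 + 1 <= m)).-1 = (d - p - 1)%N by lia.
  rewrite !addn0 mulrBl !addrA; congr (_ + _ + _).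
  - by ring.
  - apply: eq_big_nat => r r_lt; rewrite mulrBl.
    by have -> : (d - (p + r + 1) + (p + r + 1 <= m)).-1 = (d - p - r - 1)%N by lia.
  - apply: eq_big_nat => r r_lt; rewrite mulrBl.
    by have -> : (d - (p + r + 1) + (p + r + 1 <= m)).-1 = (d - p - r - 2)%N by lia.
(* Case (5): rows beyond [m] have height at most [q], so every row in the sum is at most [m] and
   nothing splits. *)
split=> [pq pm qm|].
  have -> : (d.+1 - q - (m + q < d) - p.+1 = (d - p - q - 1).+1)%N by lia.
  rewrite big_ltn //.
  have -> : (d - p + (p <= m)).-1 = (d - p)%N by lia.
  have -> : (d - (p + 0 + 1) + (p + 0 + 1 <= m)).-1 = (d - p - 1)%N by lia.
  rewrite !addn0 mulrBl !addrA; congr (_ + _); first by ring.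
  apply: eq_big_nat => r r_lt; rewrite mulrBl.
  by have -> : (d - (p + r + 1) + (p + r + 1 <= m)).-1 = (d - p - r - 1)%N by lia.
(* Cases (6) and (7): all rows after [p] lie beyond [m]; the two cases differ only in the height of
   row [p]. *)
split=> [pq pm|pq pm].
  subst p.
  have -> : (d.+1 - q - (m + q < d) - m.+1 = (d - m - q - 2).+1)%N by lia.
  rewrite big_ltn //.
  have -> : (d - m + (m <= m)).-1 = (d - m)%N by lia.
  have -> : (d - (m + 0 + 1) + (m + 0 + 1 <= m)).-1 = (d - m - 2)%N by lia.
  rewrite !addn0 mulrBl !addrA; congr (_ + _); first by ring.
  apply: eq_big_nat => r r_lt; rewrite mulrBl.
  by have -> : (d - (m + r + 1) + (m + r + 1 <= m)).-1 = (d - m - r - 2)%N by lia.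
have -> : (d.+1 - q - (m + q < d) - p.+1 = (d - p - q - 2).+1)%N by lia.
rewrite big_ltn //.
have -> : (d - p + (p <= m)).-1 = (d - p - 1)%N by lia.
have -> : (d - (p + 0 + 1) + (p + 0 + 1 <= m)).-1 = (d - p - 2)%N by lia.
rewrite !addn0 mulrBl !addrA; congr (_ + _); first by ring.
apply: eq_big_nat => r r_lt; rewrite mulrBl.
by have -> : (d - (p + r + 1) + (p + r + 1 <= m)).-1 = (d - p - r - 2)%N by lia.
Qed.
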